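(* Let $d\ge 3$. Every connected simplicial $d$-manifold (possibly with boundary) has a facet cycle, unless it is a single $d$-simplex.
   Context: A simplicial $d$-manifold is a finite simplicial complex homeomorphic to a $d$-dimensional manifold, possibly with boundary; its $d$-simplices are called facets. The (vertex-facet) incidence graph has a node for every vertex and every facet, with an arc $(v,f)$ whenever $v$ is a vertex of $f$. A facet cycle is a closed trail $(v_0,f_1,v_1,\dots,f_k,v_k)$ with $v_k=v_0$ in the incidence graph (no arc repeated) that passes through every facet node exactly once (vertex nodes may repeat). *)

(* Defs.v *)
From HB Require Import structures.
From mathcomp Require Import all_boot all_order all_algebra.
From mathcomp Require Import all_classical all_reals all_analysis.
Set Implicit Arguments. Unset Strict Implicit. Unset Printing Implicit Defensive.
Import Order.TTheory GRing.Theory Num.Theory.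
Import numFieldNormedType.Exports.
Local Open Scope ring_scope.

Definition simplicial_complex (n : nat) (K : {set {set 'I_n}}) : Prop :=
  finset.set0 \notin K /\
  (forall s t : {set 'I_n}, s \in K -> t != finset.set0 -> t \subset s -> t \in K).

Definition facets (n d : nat) (K : {set {set 'I_n}}) : {set {set 'I_n}} :=
  [set s in K | #|s| == d.+1]%N.

Definition single_simplex (n d : nat) (K : {set {set 'I_n}}) : Prop :=
  exists s : {set 'I_n}, #|s| = d.+1 /\
    K = [set t : {set 'I_n} | (t != finset.set0) && (t \subset s)].

(** The closed trail (v_0, f_1, v_1, ..., f_k, v_k) in the vertex-facet incidence
    graph is encoded by v0 (= v_0), vs = [v_1; ...; v_k], fs = [f_1; ...; f_k].
    Arcs are the pairs (vertex, facet); arc (v,f) exists iff v \in f and f is a facet. *)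
Definition trail_arcs (n : nat) (v0 : 'I_n) (vs : seq 'I_n) (fs : seq {set 'I_n})
  : seq ('I_n * {set 'I_n}) :=
  let ws := v0 :: vs in
  flatten [seq [:: (nth v0 ws i, nth finset.set0 fs i);
                   (nth v0 ws i.+1, nth finset.set0 fs i)] | i <- iota 0 (size fs)].

Definition is_facet_cycle (n d : nat) (K : {set {set 'I_n}})
  (v0 : 'I_n) (vs : seq 'I_n) (fs : seq {set 'I_n}) : bool :=
  [&& size vs == size fs,
      last v0 vs == v0,
      perm_eq fs (enum (facets d K)),
      all (fun a => (a.2 \in facets d K) && (a.1 \in a.2)) (trail_arcs v0 vs fs)
    & uniq (trail_arcs v0 vs fs)].

Definition has_facet_cycle (n d : nat) (K : {set {set 'I_n}}) : Prop :=
  exists (v0 : 'I_n) (vs : seq 'I_n) (fs : seq {set 'I_n}), is_facet_cycle d K v0 vs fs.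

Local Open Scope classical_set_scope.
Definition realization (R : realType) (n : nat) (K : {set {set 'I_n}}) : set 'rV[R]_n :=
  [set x | (forall i, 0 <= x ord0 i) /\ \sum_(i < n) x ord0 i = 1 /\
           finset (fun i => x ord0 i != 0) \in K].

Definition rel_open (T : topologicalType) (S U : set T) : Prop :=
  exists2 O : set T, open O & U = S `&` O.

Definition homeomorphic (T1 T2 : topologicalType) (A : set T1) (B : set T2) : Prop :=
  exists (f : T1 -> T2) (g : T2 -> T1),
    [/\ {within A, continuous f}, {within B, continuous g},
        f @` A `<=` B /\ g @` B `<=` A,
        (forall x, A x -> g (f x) = x) & (forall y, B y -> f (g y) = y)].

Definition halfspace (R : realType) (d : nat) : set 'rV[R]_d :=
  [set y | forall i : 'I_d, nat_of_ord i = 0%N -> 0 <= y ord0 i].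

Definition manifold_with_boundary (R : realType) (m d : nat) (S : set 'rV[R]_m) : Prop :=
  forall x, S x -> exists (U : set 'rV[R]_m) (W : set 'rV[R]_d),
    [/\ U x, rel_open S U, rel_open (@halfspace R d) W & homeomorphic U W].

Definition simplicial_manifold (R : realType) (n d : nat) (K : {set {set 'I_n}}) : Prop :=
  simplicial_complex K /\ manifold_with_boundary d (@realization R n K).

(* Main.v *)
(* A manifold is pure and strongly connected: each simplex lies in a facet, and any two
   facets are joined by a chain of facets in which neighbours share d vertices. As
   d >= 3, a facet sharing d vertices with a facet g of a given facet cycle can be
   spliced into the cycle next to g, so starting from two adjacent facets a facet
   cycle grows until it contains all of them.

   Both properties follow from a mod 2 Poincare-Miranda argument. In a chart, a
   maximal simplex of dimension < d would contain an embedded d-cube; and if the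
   complex were the union of two subcomplexes meeting in dimension <= d-2, a tube
   joining the two sides would be separated by a set of dimension <= d-2. Covering
   such a low-dimensional set by few families of small disjoint cells yields a
   labelling of a fine cubical grid without a fully labelled cube. *)
Require Import Defs.
From HB Require Import structures.
From mathcomp Require Import all_boot all_order all_algebra.
From mathcomp Require Import all_classical all_reals all_analysis.
Import numFieldNormedType.Exports.
From mathcomp Require Import ring lra zify.
Import Order.TTheory GRing.Theory Num.Theory.

(** * Cubical cup products modulo 2 *)

Section CubicalCup.
Local Open Scope ring_scope.
Variables (V : zmodType) (I : finType) (e : I -> V) (lam : I -> V -> 'F_2).

Lemma F2_addxx (x : 'F_2) : x + x = 0.
Proof. by case: x => [[|[|]]] // i; apply/val_inj. Qed.

(** The terms at (i, j) and (j, i) cancel in pairs; an injective rank [r] splits the off-diagonal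
    pairs into these two halves. *)
Lemma F2_sum_offdiag (J : {set I}) (f : I -> I -> 'F_2) :
  (forall i j, f i j = f j i) ->
  \sum_(i in J) \sum_(j in J :\ i) f i j = 0.
Proof.
move=> fC; 
have [r r_inj] : exists r : I -> nat, injective r.
  by exists (fun i => nat_of_ord (enum_rank i)) => i j /ord_inj/enum_rank_inj.
have split_i i : i \in J ->
    \sum_(j in J :\ i) f i j =
    \sum_(j in J | (r j < r i)%N) f i j + \sum_(j in J | (r i < r j)%N) f i j.
  move=> iJ; rewrite (bigID (fun j => (r j < r i)%N)) /=; congr (_ + _);
    apply: eq_bigl => j; rewrite !inE; have [->|nji] := eqVneq j i;
    rewrite ?ltnn ?andbF //= -leqNgt.
  by rewrite ltn_neqAle (inj_eq r_inj) eq_sym nji.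
rewrite (eq_bigr _ split_i) big_split /=.
rewrite [X in _ + X](exchange_big_dep (mem J)) /=; last by move=> i j _ /andP[].
rewrite -[RHS](F2_addxx (\sum_(i in J) \sum_(j in J | (r j < r i)%N) f i j)).
congr (_ + _); apply: eq_bigr => i iJ; apply: eq_big => [j|j _]; last exact: fC.
by rewrite iJ.
Qed.

(* The cubical cup product of the coboundaries of the [lam l], [l] in [s],
   evaluated mod 2 on the cube with least corner [b] and set of edge directions [J]. *)
Fixpoint cup (s : seq I) (b : V) (J : {set I}) : 'F_2 :=
  if s is l :: s' then
    \sum_(i in J) (lam l (b + e i) + lam l b) * cup s' (b + e i) (J :\ i)
  else 1.

(** A cup product of coboundaries is a cocycle: its values on the near and far facets of a cube add
    up to zero. In the inductive step the expansion becomes an off-diagonal sum of a symmetric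
    function of two directions. *)
Lemma cup_closed s b (J : {set I}) :
  \sum_(i in J) (cup s (b + e i) (J :\ i) + cup s b (J :\ i)) = 0.
Proof.
elim: s b J => [|m s IH] b J /=.
  by rewrite big1 // => i _; rewrite F2_addxx.
(* Modulo 2, a vanishing total means that far and near facets have equal sums. *)
have IH' c (J' : {set I}) : \sum_(i in J') cup s (c + e i) (J' :\ i) =
    \sum_(i in J') cup s c (J' :\ i).
  apply/eqP; rewrite -subr_eq0 -sumrB; apply/eqP; rewrite -[RHS](IH c J').
  apply: eq_bigr => i _; congr (_ + _).
  by apply/eqP; rewrite eq_sym -addr_eq0 F2_addxx.
rewrite big_split /=.
pose A i j := cup s (b + e i + e j) (J :\ i :\ j).
pose B i j := cup s (b + e i) (J :\ i :\ j).
have setD1C i j : J :\ i :\ j = J :\ j :\ i.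
  by rewrite !finset.setDDl finset.setUC.
have AB i : \sum_(j in J :\ i) A i j = \sum_(j in J :\ i) B i j by exact: IH'.
have lamA i : \sum_(j in J :\ i) lam m (b + e i) * A i j =
    \sum_(j in J :\ i) lam m (b + e i) * B i j.
  by rewrite -!mulr_sumr AB.
rewrite (_ : \sum_(i in J) _ = \sum_(i in J) \sum_(j in J :\ i)
    (lam m (b + e i + e j) * A i j + lam m (b + e i) * B i j)); last first.
  apply: eq_bigr => i _; rewrite big_split /= -lamA -big_split.
  by apply: eq_bigr => j _; rewrite mulrDl.
rewrite (_ : \sum_(i in J) \sum_(j in J :\ i) _ * cup s (b + e _) _ =
    \sum_(i in J) \sum_(j in J :\ i)
    (lam m (b + e j) * B j i + lam m b * cup s b (J :\ i :\ j))); last first.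
  apply: eq_bigr => i _; rewrite [in RHS]big_split /= -[X in _ = _ + X]mulr_sumr.
  rewrite -IH' mulr_sumr -big_split; apply: eq_bigr => j _.
  by rewrite mulrDl /B setD1C.
rewrite -big_split -[RHS](F2_sum_offdiag J (fun i j =>
  lam m (b + e i + e j) * A i j + lam m (b + e i) * B i j +
  (lam m (b + e j) * B j i + lam m b * cup s b (J :\ i :\ j)))).
  by apply: eq_bigr => i _; rewrite -big_split.
move=> i j; rewrite /A setD1C (addrAC b (e i)); ring.
Qed.

(** Leibniz rule: the product for [s] is closed, so multiplying it by the coboundary of [lam l]
    gives the coboundary of [lam l] times it. In this form the sum over a grid telescopes. *)
Lemma cup_cons_boundary l s b (J : {set I}) :
  cup (l :: s) b J =
  \sum_(i in J) (lam l (b + e i) * cup s (b + e i) (J :\ i) + lam l b * cup s b (J :\ i)).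
Proof.
have := cup_closed s b J; rewrite big_split /= => /eqP.
rewrite addr_eq0 => /eqP H.
rewrite big_split /= -[X in _ = _ + X]mulr_sumr -[X in _ = _ + _ * X]opprK -H.
rewrite mulrN (_ : - _ = lam l b * \sum_(i in J) cup s (b + e i) (J :\ i)); last first.
  by apply/eqP; rewrite eq_sym -addr_eq0 F2_addxx.
by rewrite mulr_sumr -big_split; apply: eq_bigr => i _; rewrite mulrDl.
Qed.

(** A nonzero value contains a nonzero term, that is, a monotone edge path in the cube along whose
    successive edges the successive labels of [s] change. *)
Lemma cup_neq0 s b (J : {set I}) : cup s b J != 0 ->
  forall l, l \in s -> exists A A' : {set I}, [/\ A \subset J, A' \subset J &
    lam l (b + \sum_(i in A) e i) != lam l (b + \sum_(i in A') e i)].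
Proof.
elim: s b J => [|m s IH] b J //= cup_n0.
have [i iJ] : exists2 i, i \in J &
    (lam m (b + e i) + lam m b) * cup s (b + e i) (J :\ i) != 0.
  apply/exists_inP; apply: contraNT cup_n0 => /exists_inPn H.
  by rewrite big1 // => i /H; rewrite negbK => /eqP.
rewrite mulf_eq0 negb_or => /andP[lam_n0 /IH{}IH] l.
rewrite inE => /predU1P[->|ls].
  exists [set i], finset.set0; rewrite finset.sub1set iJ finset.sub0set big_set1 big_set0 addr0.
  by split=> //; apply: contraNneq lam_n0 => ->; rewrite F2_addxx.
have [A [A' [sA sA' AA']]] := IH l ls.
have iNA (C : {set I}) : C \subset J :\ i -> (i |: C \subset J) /\
    b + \sum_(j in i |: C) e j = b + e i + \sum_(j in C) e j.
  move=> sC; rewrite big_setU1 ?addrA; last first.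
    by apply/negP => /(fintype.subsetP sC); rewrite !inE eqxx.
  split=> //; rewrite finset.subUset finset.sub1set iJ.
  exact: fintype.subset_trans sC (finset.subsetDl _ _).
exists (i |: A), (i |: A').
by have [-> ->] := iNA A sA; have [-> ->] := iNA A' sA'.
Qed.

End CubicalCup.

(** * A discrete Poincare-Miranda theorem on a cubical grid *)

Section Kuhn.
Local Open Scope ring_scope.
Variables (d N : nat) (lam : 'I_d -> {ffun 'I_d -> 'I_N.+2} -> bool).
Local Notation V := {ffun 'I_d -> 'I_N.+2}.
Hypothesis lam_low : forall i (b : V), b i = 0 -> lam i b = false.
Hypothesis lam_high : forall i (b : V), b i = ord_max -> lam i b = true.

Let e (i : 'I_d) : V := [ffun j => if j == i then 1 else 0].
Let lamF (i : 'I_d) (b : V) : 'F_2 := (lam i b)%:R.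
(** Addition in [V] is modulo [N.+2]. Keeping the coordinates from [k] on below the maximum prevents
    the cubes spanned by these directions from wrapping around. *)
Let box (k : nat) (b : V) := [forall i, (b i == ord_max) == (i < k)%N].

Lemma sum_stepE (A : {set 'I_d}) (i : 'I_d) : (\sum_(j in A) e j) i = (i \in A)%:R.
Proof.
rewrite sum_ffunE (eq_bigr (fun j => if i == j then 1 else 0)); last first.
  by move=> j _; rewrite ffunE.
rewrite -big_mkcondr /=; have [iA|iA] := boolP (i \in A).
  rewrite (big_pred1 i) // => j /=; rewrite eq_sym.
  by have [->|] := eqVneq j i; rewrite ?iA ?andbF.
by rewrite big1 // => j /andP[jA /eqP ij]; rewrite -ij (negPf iA) in jA *.
Qed.

(** The cube lies in a face of the grid where label [i] is constant, so the coboundary of that label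
    vanishes on it. *)
Lemma cup_flat i s (b : V) (J : {set 'I_d}) :
  i \in s -> i \notin J -> (b i = 0 \/ b i = ord_max) -> cup _ _ e lamF s b J = 0.
Proof.
move=> si iJ bi; apply/eqP; apply/negPn/negP => /cup_neq0/(_ i si)[A [A' [sA sA']]].
have fix_i (C : {set 'I_d}) : C \subset J -> (b + \sum_(j in C) e j) i = b i.
  by move=> sC; rewrite ffunE sum_stepE (contraNF (fintype.subsetP sC i)) ?addr0.
have lamE (C : {set 'I_d}) : C \subset J ->
    lamF i (b + \sum_(j in C) e j) = (b i == ord_max)%:R.
  move=> /fix_i biE; rewrite /lamF; case: bi => bi0; rewrite bi0 in biE *.
    by rewrite lam_low.
  by rewrite lam_high // eqxx.
by rewrite !lamE ?eqxx.
Qed.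

(* [T 0] is a mod 2 count over all cubes of the grid; by Stokes it equals the count
   [T k] over the cubes of the face where the first [k] coordinates are maximal. *)
Let T k := \sum_(b | box k b)
  cup _ _ e lamF (drop k (enum 'I_d)) b [set i : 'I_d | (k <= i)%N].

Lemma face_count_last : T d = 1.
Proof.
rewrite /T drop_oversize ?size_enum_ord //=.
rewrite (big_pred1 [ffun=> ord_max]) // => b; apply/forallP/eqP => [H|-> i].
  by apply/ffunP => i; rewrite ffunE; have := H i; rewrite ltn_ord eqb_id => /eqP.
by rewrite ffunE eqxx ltn_ord.
Qed.

(** Telescoping in direction [i]: every layer is counted twice, and so cancels, except the layers
    where coordinate [i] is 0 or maximal. *)
Lemma box_shift (i : 'I_d) k (F : V -> 'F_2) : (k <= i)%N ->
  \sum_(b | box k b) F (b + e i) + \sum_(b | box k b) F b =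
  \sum_(b : V | [forall j, (j == i) || ((b j == ord_max) == (j < k)%N)] && (b i == 0)) F b +
  \sum_(b : V | [forall j, (j == i) || ((b j == ord_max) == (j < k)%N)] && (b i == ord_max)) F b.
Proof.
move=> ki; pose P (b : V) := [forall j, (j == i) || ((b j == ord_max) == (j < k)%N)].
have boxP b : box k b = P b && (b i != ord_max).
  apply/forallP/andP => [H|[/forallP H bi] j].
    split; first by apply/forallP => j; rewrite H orbT.
    by have := H i; rewrite ltnNge ki eqbF_neg.
  have [->|ji] := eqVneq j i; first by rewrite ltnNge ki (negPf bi).
  by have := H j; rewrite (negPf ji).
have max0 : ord_max != 0 :> 'I_N.+2 by [].
have maxS (x : 'I_N.+2) : (x + 1 == 0) = (x == ord_max).
  rewrite addr_eq0; congr (_ == _); apply/val_inj.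
  by rewrite /= (@modn_small 1) // subn1 modn_small.
have shift : \sum_(b | box k b) F (b + e i) = \sum_(b | P b && (b i != 0)) F b.
  rewrite [RHS](reindex (fun b : V => b + e i)) /=; last first.
    by exists (fun b : V => b - e i) => b _; rewrite ?addrK ?subrK.
  apply: eq_bigl => b; rewrite boxP !ffunE eqxx maxS; congr (_ && _).
  apply: eq_forallb => j; rewrite !ffunE.
  by case: eqVneq => //= _; rewrite addr0.
rewrite shift -/P (eq_bigl _ _ boxP).
rewrite (bigID (fun b : V => b i == ord_max)) /=.
rewrite (bigID (fun b : V => b i == 0) (fun b => P b && (b i != ord_max))) /=.
rewrite addrACA [X in _ + X = _](_ : _ = 0).
  rewrite addr0 addrC; congr (_ + _); apply: eq_bigl => b;
  rewrite -andbA; congr (_ && _); apply/andb_idl.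
    by move=> /eqP->; rewrite eq_sym max0.
  by move=> /eqP->.
rewrite (eq_bigl _ _ (fun b => andbAC (P b) (b i != 0) _)).
exact: F2_addxx.
Qed.

(** Stokes: only boundary layers survive. In a direction beyond [k] they contribute nothing by
    [cup_flat]. In direction [k] the low layer has label 0, and the high layer has label 1 and
    yields [T k.+1]. *)
Lemma face_count_step k : (k < d)%N -> T k = T k.+1.
Proof.
move=> kd; pose ik := Ordinal kd.
have dropE : drop k (enum 'I_d) = ik :: drop k.+1 (enum 'I_d).
  by rewrite (drop_nth ik) ?size_enum_ord // -[k in nth _ _ k]/(nat_of_ord ik) nth_ord_enum.
have mem_drop' (i : 'I_d) : (k < i)%N -> i \in drop k.+1 (enum 'I_d).
  move=> ki; rewrite -(nth_ord_enum i i) -(subnKC ki) -nth_drop mem_nth //.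
  by rewrite size_drop size_enum_ord ltn_sub2r // (leq_ltn_trans ki).
rewrite /T dropE; under eq_bigr do rewrite cup_cons_boundary.
rewrite exchange_big /= (bigD1 ik) ?inE //= [X in _ + X]big1 ?addr0 => [|i]; last first.
  rewrite inE => /andP[ki iNk]; have {ki iNk}ki : (k < i)%N.
    by rewrite ltn_neqAle ki andbT eq_sym.
  rewrite big_split /= (box_shift i k (fun b => lamF ik b * cup _ _ e lamF
    (drop k.+1 (enum 'I_d)) b ([set i : 'I_d | (k <= i)%N] :\ i))) ?(ltnW ki) //.
  have flat (b : V) : b i = 0 \/ b i = ord_max -> cup _ _ e lamF
      (drop k.+1 (enum 'I_d)) b ([set i : 'I_d | (k <= i)%N] :\ i) = 0.
    by apply: cup_flat; rewrite ?mem_drop' // !inE eqxx.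
  by rewrite !big1 ?addr0 // => b /andP[_ /eqP bi]; rewrite flat ?mulr0 //; [right|left].
rewrite big_split /= (box_shift ik k (fun b => lamF ik b * cup _ _ e lamF
    (drop k.+1 (enum 'I_d)) b ([set i : 'I_d | (k <= i)%N] :\ ik))) //.
rewrite big1 ?add0r => [|b /andP[_ /eqP bk]]; last first.
  by rewrite /lamF lam_low ?mul0r.
apply: eq_big => [b|b /andP[_ /eqP bk]]; last first.
  rewrite /lamF lam_high // mul1r; congr (cup _ _ _ _ _ _ _).
  by apply/setP => j; rewrite !inE ltn_neqAle eq_sym.
apply/andP/forallP => [[/forallP H bk] j|H].
  rewrite ltnS leq_eqVlt; have [->|jk] := eqVneq j ik; first by rewrite bk eqxx.
  by have := H j; rewrite (negPf jk) [(j == k :> nat)](negPf jk).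
split; last by have := H ik; rewrite ltnSn eqb_id.
apply/forallP => j; have := H j; rewrite ltnS leq_eqVlt.
by have [|jk] := eqVneq j ik; rewrite //= [(j == k :> nat)](negPf jk).
Qed.

Lemma cubical_kuhn : exists b : V, forall l, exists x y : V,
  [/\ forall i, (b i <= x i <= (b i).+1)%N, forall i, (b i <= y i <= (b i).+1)%N
    & lam l x != lam l y].
Proof.
have TE k : (k <= d)%N -> T (d - k) = 1.
  elim: k => [|k IH] kd; first by rewrite subn0 face_count_last.
  have lt_d : (d - k.+1 < d)%N by lia.
  by rewrite face_count_step // subnSK // IH // ltnW.
have T0 : T 0 = 1 by have := TE d (leqnn d); rewrite subnn.
have [b bb cup_n0] : exists2 b, box 0 b &
    cup _ _ e lamF (enum 'I_d) b [set i : 'I_d | (0 <= i)%N] != 0.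
  apply/exists_inP; have : T 0 != 0 by rewrite T0.
  apply: contraNT => /exists_inPn H; rewrite /T drop0 big1 // => b /H.
  by rewrite negbK => /eqP.
exists b => l.
have [A [A' [_ _ AA']]] := cup_neq0 _ _ _ _ _ _ _ cup_n0 l (mem_enum _ l).
have near (C : {set 'I_d}) i : (b i <= (b + \sum_(j in C) e j)%R i <= (b i).+1)%N.
  have := forallP bb i; rewrite ltn0 eqbF_neg => bi.
  have {}bi : (b i < N.+1)%N.
    by rewrite ltn_neqAle -ltnS ltn_ord andbT; exact: bi.
  rewrite ffunE sum_stepE; case: (i \in C); rewrite ?addr0 ?leqnn ?leqnSn //=.
  by rewrite !modn_small // ?addn1 ?ltnS ?leqnn ?leqnSn // ltnW.
exists (b + \sum_(j in A) e j), (b + \sum_(j in A') e j); split=> //.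
by apply: contraNneq AA' => E; rewrite /lamF E.
Qed.

End Kuhn.

(** * Small cells from shifted lattices, and cubes with thin image *)

Section ShiftedLattices.
Local Open Scope ring_scope.
Variable R : archiRealFieldType.

Lemma floor_neq_between (a b : R) : Num.floor a != Num.floor b ->
  exists m : int, `|a - m%:~R| <= `|a - b|.
Proof.
wlog ab : a b / a <= b => [H|].
  case/orP: (le_total a b) => [|ba]; first exact: H.
  rewrite eq_sym => ne; exists (Num.floor a).
  have lt_fl : Num.floor b < Num.floor a by rewrite lt_neqAle ne le_floor.
  have leaa := floor_le a; have ltba : b < (Num.floor a)%:~R by rewrite -floor_lt_int.
  by rewrite !ger0_norm; lra.
move=> ne; exists (Num.floor b).
have ltab : a < (Num.floor b)%:~R by rewrite -floor_lt_int lt_neqAle ne le_floor.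
have lebb := floor_le b; rewrite !ler0_norm; lra.
Qed.

(** Two integers within 1/3 of [u] differ by less than 1, hence coincide. *)
Lemma near_residue_inj (D j j' : nat) (m m' : int) (u : R) :
  (j < D)%N -> (j' < D)%N ->
  `|u - (m * D%:Z + j%:Z)%:~R| <= 3^-1 -> `|u - (m' * D%:Z + j'%:Z)%:~R| <= 3^-1 ->
  j = j'.
Proof.
move=> jD j'D uj uj'.
have : `|((m * D%:Z + j%:Z) - (m' * D%:Z + j'%:Z))%:~R| < 1 :> R.
  rewrite intrB; move: uj uj'; rewrite !ler_norml ltr_norml; lra.
rewrite -intr_norm ltrz1 => lt1.
have E : m * D%:Z + j%:Z = m' * D%:Z + j'%:Z by lia.
have : (j%:Z = j'%:Z %[mod D])%Z by rewrite -(modzMDl m) E modzMDl.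
by rewrite !modz_nat !modn_small //; case.
Qed.

(* The lattice of mesh [eps] shifted by [eps * (j + 1) / (d + 1)]: for [j < d] the
   walls of different lattices, and the point [0], are [eps / (d + 1)] apart. *)
Definition cell (d : nat) (eps : R) (j : nat) (x : R) : int :=
  Num.floor (x / eps - j.+1%:R / d.+1%:R).

Lemma cell_dist d eps j (x y : R) : 0 < eps ->
  cell d eps j x = cell d eps j y -> `|x - y| < eps.
Proof.
move=> e0; rewrite /cell; set a := _ - _; set b := (_ - _ in RHS) => E.
have := floor_itv a; have := floor_itv b; rewrite E.
rewrite intrD => /andP[b1 b2] /andP[a1 a2].
have -> : x - y = (a - b) * eps.
  have -> : a - b = (x - y) / eps by rewrite /a /b; ring.
  by rewrite divfK ?gt_eqF.
rewrite normrM (gtr0_norm e0). rewrite gtr_pMl // ltr_norml; lra.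
Qed.

(** A wall separates [x] from [y], so [x] is close to it. Scaling by (d + 1) / eps turns the walls
    of the [j]-th lattice into the integers congruent to j + 1 modulo d + 1, and the given distance
    bound into 1/3. *)
Lemma cell_neq_near d eps j (x y : R) : 0 < eps ->
  `|x - y| <= eps / (3 * d.+1%:R) -> cell d eps j x != cell d eps j y ->
  exists m : int, `|x * d.+1%:R / eps - (m * d.+1%:Z + j.+1%:Z)%:~R| <= 3^-1.
Proof.
move=> e0 xy /floor_neq_between[m Hm]; exists m.
have D0 : 0 < d.+1%:R :> R by rewrite ltr0n.
have -> : x * d.+1%:R / eps - (m * d.+1%:Z + j.+1%:Z)%:~R =
   (x / eps - j.+1%:R / d.+1%:R - m%:~R) * d.+1%:R.
  rewrite intrD intrM -!pmulrn !mulrBl [j.+1%:R / _ * _]divfK ?gt_eqF //; ring.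
rewrite normrM (gtr0_norm D0) -ler_pdivlMr // (le_trans Hm) //.
have -> : x / eps - j.+1%:R / d.+1%:R - (y / eps - j.+1%:R / d.+1%:R) = (x - y) / eps.
  by ring.
by rewrite normrM normfV (gtr0_norm e0) ler_pdivrMr // (le_trans xy) // invfM mulrC.
Qed.

(* For [j] in [J] give a grid point label [0] when its image shares its cell of the
   [j]-th shifted lattice with the image of a point of the face [z_j = 0]. A coordinate
   of the image is near a wall of at most one of the shifted lattices, and of none if
   it is near [0]; so an image with fewer than [#|J|] large coordinates indexed by [v]
   is, for some [j], far from all walls of the [j]-th lattice, and there label [j]
   cannot change, contradicting [cubical_kuhn]. *)
Lemma no_thin_cube (d n : nat) (g : 'rV[R]_d -> 'rV[R]_n)
    (lab : 'I_d -> 'rV[R]_d -> bool) (J : {set 'I_d}) (v : pred 'I_n) (eps : R) :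
  let cube (z : 'rV[R]_d) := forall i, 0 <= z ord0 i <= 1 in
  0 < eps ->
  (forall i z, i \notin J -> cube z -> z ord0 i = 0 -> lab i z = false) ->
  (forall i z, i \notin J -> cube z -> z ord0 i = 1 -> lab i z = true) ->
  (forall j z z', j \in J -> cube z -> cube z' -> z ord0 j = 0 -> z' ord0 j = 1 ->
     exists2 i, v i & eps <= `|g z ord0 i - g z' ord0 i|) ->
  (forall eta : R, 0 < eta -> exists2 delta : R, 0 < delta & forall z z', cube z -> cube z' ->
     (forall i, `|z ord0 i - z' ord0 i| <= delta) ->
     forall i, `|g z ord0 i - g z' ord0 i| <= eta) ->
  (forall (eta : R) (C : 'rV[R]_d -> Prop), 0 < eta -> (forall z, C z -> cube z) ->
     (exists z, C z) ->
     (forall z z', C z -> C z' -> forall i, `|g z ord0 i - g z' ord0 i| <= eta) ->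
     (forall i, i \notin J -> exists z z', [/\ C z, C z' & lab i z != lab i z']) ->
     exists2 z, C z & (#|[set i | v i && (eta < `|g z ord0 i|)%R]| < #|J|)%N) ->
  False.
Proof.
move=> cube e0 lab0 lab1 sep uc thin.
pose eta := eps / (3 * d.+1%:R).
have eta0 : 0 < eta by rewrite divr_gt0 // mulr_gt0 // ltr0n.
have [delta delta0 ucd] := uc eta eta0.
pose N := Num.bound delta^-1.
have N1 : 0 < N.+1%:R :> R by rewrite ltr0n.
have N_delta : N.+1%:R^-1 <= delta.
  rewrite -[leRHS]invrK lef_pV2 ?posrE ?invr_gt0 //.
  have := @archi_boundP R delta^-1; rewrite invr_ge0 ltW // => /(_ isT)/ltW/le_trans.
  by apply; rewrite ler_nat.
pose V := {ffun 'I_d -> 'I_N.+2}.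
pose pt (b : V) : 'rV[R]_d := \row_i ((b i)%:R / N.+1%:R).
have ptE b i : pt b ord0 i = (b i)%:R / N.+1%:R by rewrite mxE.
have pt_cube b : cube (pt b).
  move=> i; rewrite ptE divr_ge0 //= ler_pdivrMr // mul1r ler_nat.
  by rewrite -ltnS.
(* The constant 0 outside [v] makes signatures compare cells on [v] only. *)
pose sig (j : 'I_d) z := [ffun i : 'I_n => if v i then cell d eps j (g z ord0 i) else 0].
pose lam (j : 'I_d) (b : V) := if j \in J
  then ~~ [exists b' : V, (b' j == 0) && (sig j (pt b') == sig j (pt b))]
  else lab j (pt b).
have lam0 i (b : V) : b i = 0 -> lam i b = false.
  move=> bi; rewrite /lam; case: ifPn => iJ.
    by apply/negbTE; rewrite negbK; apply/existsP; exists b; rewrite bi !eqxx.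
  by rewrite lab0 // ptE bi mul0r.
have lam1 i (b : V) : b i = ord_max -> lam i b = true.
  move=> bi; rewrite /lam; case: ifPn => iJ; last first.
    by rewrite lab1 // ptE bi divff // gt_eqF.
  apply/existsPn => b'; apply/negP => /andP[/eqP b'i /eqP E].
  have [] := sep i (pt b') (pt b) iJ (pt_cube _) (pt_cube _).
  - by rewrite ptE b'i mul0r.
  - by rewrite ptE bi divff // gt_eqF.
  move=> k vk; apply/negP; rewrite -ltNge.
  have := congr1 (fun f : {ffun 'I_n -> int} => f k) E; rewrite !ffunE vk.
  exact: cell_dist.
have [b Hb] := cubical_kuhn d N lam lam0 lam1.
pose inb (c : V) := [forall i, (b i <= c i <= (b i).+1)%N].
pose C z := exists2 c : V, inb c & z = pt c.
have C_close z z' : C z -> C z' -> forall i, `|g z ord0 i - g z' ord0 i| <= eta.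
  move=> [c /forallP bc ->] [c' /forallP bc' ->]; apply: ucd => // i.
  rewrite !ptE -mulrBl normrM normfV (gtr0_norm N1) ler_pdivrMr //.
  apply: (@le_trans _ _ 1); last by rewrite -ler_pdivrMr // div1r.
  have /andP[] := bc i; have /andP[] := bc' i.
  rewrite -!(ler_nat R) -![(b i).+1%:R]natr1 ler_norml; lra.
have [||||z [cz bcz Ez] thinz] := thin eta C eta0.
- by move=> _ [c _ ->].
- by exists (pt b), b => //; apply/forallP => i; rewrite leqnn leqnSn.
- exact: C_close.
- move=> i iJ; have [x [y [bx yb xy]]] := Hb i.
  exists (pt x), (pt y); split; [exists x => //|exists y => //|].
  + exact/forallP. + exact/forallP.
  by move: xy; rewrite /lam (negPf iJ).
have Cz : C z by exists cz.
pose bad j i := v i && [exists c : V, inb c &&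
  (cell d eps j (g z ord0 i) != cell d eps j (g (pt c) ord0 i))].
have badP j i : bad j i -> v i /\ exists m : int,
    `|g z ord0 i * d.+1%:R / eps - (m * d.+1%:Z + j.+1%:Z)%:~R| <= 3^-1.
  case/andP=> vi /existsP[c /andP[bc ne]]; split=> //.
  by apply: (cell_neq_near d eps j _ _ e0 _ ne); apply: C_close => //; exists c.
have bad_inj (j j' : 'I_d) i : bad j i -> bad j' i -> j = j'.
  move=> /badP[_ [m Hm]] /badP[_ [m' Hm']]; apply/val_inj/succn_inj.
  by apply: (near_residue_inj _ _ _ _ _ _ _ _ Hm Hm'); rewrite ltnS.
have bad_large (j : 'I_d) i : bad j i -> v i && (eta < `|g z ord0 i|).
  move=> /badP[-> [m Hm]] /=; rewrite ltNge; apply/negP => small.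
  (* A small coordinate scales to within 1/3 of the integer 0, whose residue differs from j + 1,
     which lies between 1 and d. *)
  suff : j.+1 = 0%N by [].
  apply: (near_residue_inj d.+1 _ _ m 0 _ _ _ Hm) => //; first by rewrite ltnS.
  rewrite mul0r add0r subr0 normrM normfV (gtr0_norm e0) ler_pdivrMr // normrM.
  by rewrite normr_nat -ler_pdivlMr ?ltr0n // (le_trans small) // /eta invfM mulrA (mulrC eps).
have [j jJ /forallP good] : exists2 j : 'I_d, j \in J & [forall i, ~~ bad j i].
  apply/exists_inP; apply: contraLR thinz => /exists_inPn all_bad.
  (* If every lattice had a bad coordinate, choosing one for each would inject [J] into the set of
     large coordinates. *)
  pose f (j : 'I_d) := [pick i | bad j i].
  have fP j : j \in J -> exists2 i, f j = Some i & bad j i.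
    move=> jJ; rewrite /f; case: pickP => [i bi|none]; first by exists i.
    by have := all_bad j jJ; rewrite negb_forall => /existsP[i]; rewrite negbK none.
  rewrite -leqNgt -(card_in_imset (f := f) (D := J)); last first.
    move=> j j' /fP[i -> bi] /fP[i' -> bi'] [ii'].
    by apply: (bad_inj _ _ i) => //; rewrite ii'.
  have Some_I_inj : injective (@Some 'I_n) by move=> ? ? [].
  rewrite -(card_imset _ Some_I_inj); apply/subset_leq_card/fintype.subsetP => y.
  move=> /imsetP[j0 j0J ->{y}]; have [i -> bi] := fP j0 j0J.
  by apply/imset_f; rewrite inE (bad_large j0).
have [x [y [bx yb xy]]] := Hb j.
have sigE c : inb c -> sig j (pt c) = sig j z.
  move=> bc; apply/ffunP => i; rewrite !ffunE; case: ifP => // vi.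
  have := good i; rewrite /bad vi /= => /existsPn/(_ c).
  by rewrite bc negbK => /eqP.
by move: xy; rewrite /lam jJ !sigE ?eqxx //; apply/forallP.
Qed.
End ShiftedLattices.

(** * Growing a closed trail through the facets *)

Section FacetCycle.
Variables (n : nat).
Local Notation item := ({set 'I_n} * 'I_n)%type.

(* The pair [(f, v)] stands for a visit of the facet [f] left through the vertex [v]. *)
Definition trail_step : rel item :=
  fun a b => [&& a.2 \in b.1, b.2 \in b.1 & a.2 != b.2].

Definition step_arcs (a b : item) : seq ('I_n * {set 'I_n}) := [:: (a.2, b.1); (b.2, b.1)].

Lemma trail_arcsE (a : item) (s : seq item) :
  trail_arcs a.2 (unzip2 s) (unzip1 s) = flatten (pairmap step_arcs a s).
Proof.
(* The default value of [nth] is generalised because the induction changes [a]. *)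
rewrite /trail_arcs; move: {1 3}a.2 => w; congr flatten.
elim: s a => [|b s IH] a //=; congr cons.
by rewrite -IH -[1%N]/(1 + 0)%N iotaDl -map_comp.
Qed.

Lemma arc_facet_mem (a : item) s x :
  x \in flatten (pairmap step_arcs a s) -> x.2 \in unzip1 s.
Proof.
elim: s a => [|b s IH] a //=; rewrite !inE => /or3P[/eqP->|/eqP->|/IH ->].
- by rewrite eqxx.
- by rewrite eqxx.
- by rewrite orbT.
Qed.

(** Arcs at different facets differ, and the two arcs at one facet differ because it is entered and
    left through distinct vertices. *)
Lemma trail_arcs_uniq (a : item) s : path trail_step a s -> uniq (unzip1 s) ->
  uniq (flatten (pairmap step_arcs a s)).
Proof.
elim: s a => [|b s IH] a //= /andP[/and3P[_ _ ab] ps] /andP[bs us].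
rewrite IH // andbT !inE xpair_eqE (negPf ab) /=.
by apply/andP; split; apply/negP => /arc_facet_mem; apply/negP.
Qed.

Lemma trail_arcs_incident (a : item) s : path trail_step a s ->
  all (fun x : 'I_n * {set 'I_n} => x.1 \in x.2) (flatten (pairmap step_arcs a s)).
Proof.
by elim: s a => [|b s IH] a //= /andP[/and3P[-> -> _] /IH].
Qed.

Lemma facet_cycle_of_path d (K : {set {set 'I_n}}) (a : item) s :
  path trail_step a s -> (last a s).2 = a.2 -> perm_eq (unzip1 s) (enum (facets d K)) ->
  has_facet_cycle d K.
Proof.
move=> ps las permK; exists a.2, (unzip2 s), (unzip1 s).
have us : uniq (unzip1 s) by rewrite (perm_uniq permK) enum_uniq.
apply/and5P; split=> //.
- by rewrite !size_map.
- by rewrite (last_map snd s a) las.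
- rewrite trail_arcsE; apply/allP => x xs; apply/andP; split.
    by have := arc_facet_mem _ _ _ xs; rewrite (perm_mem permK) mem_enum.
  exact: (allP (trail_arcs_incident _ _ ps)).
- by rewrite trail_arcsE trail_arcs_uniq.
Qed.

(* A facet [f] is spliced in next to the visit [u g v] of an adjacent facet [g]:
   with [w] a third common vertex, [u g v] becomes [u f w g v] if [u \in f], and
   [u g w f v] if [v \in f]. *)
Lemma trail_insert (a : item) s (f g : {set 'I_n}) :
  path trail_step a s -> g \in unzip1 s ->
  (3 <= #|f :&: g|)%N -> (#|g :\: f| <= 1)%N ->
  exists s', [/\ path trail_step a s', (last a s').2 = (last a s).2
    & perm_eq (unzip1 s') (f :: unzip1 s)].
Proof.
move=> ps /mapP[[g' v] gvs /= ?]; subst g'.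
case/splitPr: gvs ps => s1 s2; rewrite cat_path /= => /and3P[ps1 /and3P[/= ug vg uv] ps2] fg gf.
set u := (last a s1).2 in ug uv.
have [w wfg uvw] : exists2 w, w \in f :&: g & (w != u) && (w != v).
  apply/exists_inP; apply: contraLR fg => /exists_inPn H; rewrite -ltnNge.
  apply: (@leq_ltn_trans #|[set u; v]|); last by rewrite cards2; case: (_ != _).
  apply/subset_leq_card/fintype.subsetP => w /H; rewrite negb_and !negbK !inE.
  by [].
move: wfg uvw; rewrite inE => /andP[wf wg] /andP[wu wv].
have [uf|uf] := boolP (u \in f).
  exists (s1 ++ (f, w) :: (g, v) :: s2); split.
  - by rewrite cat_path /= ps1 ps2 /trail_step /= -/u uf wf wg vg wv eq_sym wu.
  - by rewrite !last_cat.
  - by rewrite /unzip1 !map_cat /= perm_sym -cat1s perm_catCA.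
(* At most one vertex of [g] is missing from [f], and [u] already is. *)
have vf : v \in f.
  apply: contraLR gf => vf; rewrite -ltnNge.
  apply: (@leq_trans #|[set u; v]|); first by rewrite cards2 uv.
  apply/subset_leq_card/fintype.subsetP => x; rewrite !inE.
  by case/orP=> /eqP->; rewrite ?uf ?ug ?vf ?vg.
exists (s1 ++ (g, w) :: (f, v) :: s2); split.
- rewrite cat_path /= ps1 /trail_step /= -/u ug wg wf vf wv eq_sym wu /=.
  by case: s2 ps2.
- by rewrite !last_cat /=; case: s2 ps2.
- rewrite /unzip1 !map_cat /= perm_sym -cat1s perm_catCA perm_cat2l.
  exact/permPl/(perm_catCA [:: f] [:: g]).
Qed.

Lemma facet_cycle_of_connected d (K : {set {set 'I_n}}) : (3 <= d)%N ->
  (1 < #|facets d K|)%N ->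
  (forall P : {set {set 'I_n}}, P \proper facets d K -> P != finset.set0 ->
    exists f g, [/\ f \in facets d K, f \notin P, g \in P & (d <= #|f :&: g|)%N]) ->
  has_facet_cycle d K.
Proof.
move=> d3 F2 conn; set F := facets d K in F2 conn *.
have cardF f : f \in F -> #|f| = d.+1 by rewrite inE => /andP[_ /eqP].
have adjD f g : g \in F -> (d <= #|f :&: g|)%N -> (#|g :\: f| <= 1)%N.
  by move=> /cardF gd fg; rewrite cardsD gd finset.setIC; lia.
(* The induction starts at two facets: a closed trail cannot visit just one, since it would enter
   and leave it through the same vertex. *)
suff grow k : (k.+2 <= #|F|)%N -> exists (a : item) s,
    [/\ path trail_step a s, (last a s).2 = a.2, uniq (unzip1 s),
        {subset unzip1 s <= F} & size s = k.+2].
  have [|a [s [ps las us sF ss]]] := grow (#|F| - 2)%N; first lia.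
  apply: (facet_cycle_of_path _ _ _ _ ps las); apply: uniq_perm => //.
    exact: enum_uniq.
  have sF' : {subset unzip1 s <= enum F} by move=> f /sF; rewrite mem_enum.
  have [|_ eqF f] := uniq_min_size us sF'; last by rewrite eqF.
  by rewrite -cardE size_map ss -addn2 subnK.
elim: k => [|k IH] kF.
  have /card_gt0P[f fF] : (0 < #|F|)%N by lia.
  have [||h [g [hF hf gf fh]]] := conn [set f].
  - by rewrite properEcard finset.sub1set fF cards1.
  - by apply/finset.set0Pn; exists f; rewrite inE.
  move: gf hf fh; rewrite !inE => /eqP-> hf fh.
  have /card_gt1P[u [v [uhf vhf uv]]] : (1 < #|h :&: f|)%N by lia.
  move: uhf vhf; rewrite !inE => /andP[uh uf] /andP[vh vf].
  (* The empty set is a placeholder: the starting item only supplies the initial vertex [u]. *)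
  exists (finset.set0, u), [:: (f, v); (h, u)]; split=> //=.
  - by rewrite /trail_step /= uf vf uv vh uh eq_sym uv.
  - by rewrite inE eq_sym hf.
  - by move=> x; rewrite mem_seq2 => /orP[]/eqP->.
have [|a [s [ps las us sF ss]]] := IH _; first lia.
have Pcard : #|[set x in unzip1 s]| = k.+2.
  by rewrite cardsE (card_uniqP us) size_map.
have [||f [g [fF fP gP fg]]] := conn [set x in unzip1 s].
- rewrite properEcard Pcard kF andbT.
  by apply/fintype.subsetP => x; rewrite inE => /sF.
- by rewrite -card_gt0 Pcard.
rewrite !inE in fP gP.
have [|s' [ps' las' perm']] := trail_insert a s f g ps gP (leq_trans d3 fg).
  exact: adjD (sF _ gP) fg.
exists a, s'; split=> //; first by rewrite las'.
- by rewrite (perm_uniq perm') /= fP us.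
- by move=> x; rewrite (perm_mem perm') inE => /predU1P[->|/sF].
- by have := perm_size perm'; rewrite /= !size_map ss.
Qed.

(* Any two facets contained in a common simplex are joined by single-vertex exchanges. *)
Lemma adj_closed_in_simplex d (K : {set {set 'I_n}}) (P : {set {set 'I_n}}) t f f' :
  simplicial_complex K -> t \in K ->
  (forall f g, f \in facets d K -> f \notin P -> g \in P -> (#|f :&: g| < d)%N) ->
  P \subset facets d K ->
  f \in P -> f' \in facets d K -> f \subset t -> f' \subset t -> f' \in P.
Proof.
move=> [_ Ksub] tK closed PF; move: {2}#|f' :\: f| (leqnn #|f' :\: f|) => m.
have cardF g : g \in facets d K -> #|g| = d.+1 by rewrite inE => /andP[_ /eqP].
elim: m f => [|m IH] f.
  rewrite leqn0 cards_eq0 finset.setD_eq0 => f'f fP f'F _ _.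
  suff -> : f' = f by [].
  apply/eqP; rewrite eqEcard f'f /=.
  by rewrite (cardF _ f'F) (cardF _ (fintype.subsetP PF _ fP)).
move=> mf fP f'F ft f't.
have fF := fintype.subsetP PF _ fP.
have [f'f|/fintype.subsetPn[b bf' bf]] := boolP (f' \subset f).
  by apply: (IH f) => //; move: f'f; rewrite -finset.setD_eq0 => /eqP->; rewrite cards0.
have /fintype.subsetPn[a af af'] : ~~ (f \subset f').
  apply/negP => ff'; suff /eqP E : f == f' by rewrite E bf' in bf.
  by rewrite eqEcard ff' (cardF _ f'F) (cardF _ fF) leqnn.
(* Exchanging [a] for [b] inside [t] gives a facet sharing d vertices with [f], hence still in [P],
   and missing fewer vertices of [f']. *)
pose h := b |: (f :\ a).
have bfa : b \notin f :\ a by rewrite !inE (negPf bf) andbF.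
have cfa : #|f :\ a| = d.
  by apply/eqP; rewrite -eqSS -(cardF _ fF) (cardsD1 a f) af.
have ht : h \subset t.
  rewrite finset.subUset finset.sub1set (fintype.subsetP f't) //=.
  exact: fintype.subset_trans (finset.subsetDl _ _) ft.
have hF : h \in facets d K.
  rewrite inE cardsU1 bfa cfa eqxx andbT; apply: Ksub ht => //.
  by apply/finset.set0Pn; exists b; rewrite !inE eqxx.
have hP : h \in P.
  apply: contraT => hP; have := closed h f hF hP fP.
  rewrite ltnNge -{1}cfa => /negP[]; apply/subset_leq_card/fintype.subsetP => x.
  by rewrite !inE => /andP[-> ->]; rewrite orbT.
apply: (IH h) => //.
rewrite -ltnS (leq_trans _ mf) //; apply/proper_card/fintype.properP; split.
  apply/fintype.subsetP => x; rewrite !inE negb_or negb_and negbK.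
  case/andP=> /andP[_ /orP[/eqP->|xf]] xf'; last by rewrite xf.
  by rewrite xf' in af'.
by exists b; rewrite !inE ?eqxx ?bf ?bf' // .
Qed.
End FacetCycle.

(** * Uniform estimates from compactness of the cube *)

Section Compactness.
Local Open Scope ring_scope.
Local Open Scope classical_set_scope.
Variable R : realType.

Lemma rV_normP n (x : 'rV[R]_n) (e : R) : 0 < e ->
  reflect (forall i, `|x ord0 i| < e) (`|x| < e).
Proof.
move=> e0; rewrite [`|x|]mx_normrE; apply: (iffP idP) => [xe i|xe].
  by apply: le_lt_trans xe; exact: (le_bigmax _ (fun ij => `|x ij.1 ij.2|) (ord0, i)).
by apply/bigmax_ltP; split=> // -[i j] _ /=; rewrite (ord1 i).
Qed.

Lemma rV_near_continuous {T : topologicalType} n (f : T -> 'rV[R]_n) :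
  (forall i, continuous (fun t => f t ord0 i)) -> continuous f.
Proof.
move=> fc t; apply/cvgrPdist_lt => e e0.
have : \forall s \near t, forall i, `|f t ord0 i - f s ord0 i| < e.
  by apply: filter_forall => i; have /cvgrPdist_lt/(_ e e0) := fc i t.
apply: filterS => s H; apply/rV_normP => // i.
by rewrite !mxE.
Qed.

(** On the compact set of pairs with [G] values at least [eta] apart, the distance of the [F] values
    never vanishes, so it stays away from 0. With [F] the identity this is uniform continuity; with
    [G] the identity it is uniform continuity of the inverse. *)
Lemma compact_inverse_modulus {T : topologicalType} {U V : normedModType R}
    (C : set T) (F : T -> U) (G : T -> V) :
  compact C -> continuous F -> continuous G ->
  (forall x y, C x -> C y -> F x = F y -> G x = G y) ->
  forall eta : R, 0 < eta -> exists2 delta : R, 0 < delta &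
    forall x y, C x -> C y -> `|F x - F y| < delta -> `|G x - G y| < eta.
Proof.
move=> cC cF cG FG eta eta0.
have cdist (W : normedModType R) (H : T -> W) : continuous H ->
    continuous (fun p : T * T => `|H p.1 - H p.2|).
  move=> cH p; apply: cvg_norm; apply: cvgB.
    by apply: cvg_comp; [exact: cvg_fst|exact: cH].
  by apply: cvg_comp; [exact: cvg_snd|exact: cH].
pose far := (C `*` C) `&` [set p : T * T | eta <= `|G p.1 - G p.2|].
have cfar : compact far.
  apply: compact_closedI; first exact: compact_setX.
  by apply: (preimage_closed (D := [set x : R | eta <= x])) => [p _|]; [exact: cdist|exact: closed_ge].
have cim : closed [set `|F p.1 - F p.2| | p in far].
  apply: compact_closed; first exact: Rhausdorff.
  apply: continuous_compact => //; apply: continuous_subspaceT.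
  exact: cdist.
have n0 : (~` [set `|F p.1 - F p.2| | p in far]) 0.
  move=> [[x y] [/= [Cx Cy] le_eta]] /eqP; rewrite normr_eq0 subr_eq0 => /eqP.
  move=> /(FG _ _ Cx Cy) E; move: le_eta; rewrite E subrr normr0.
  by rewrite leNgt eta0.
have /nbhs_ballP[delta /= delta0 Hd] := open_nbhs_nbhs (conj (closed_openC cim) n0).
exists delta => // x y Cx Cy lt_delta; rewrite ltNge; apply/negP => le_eta.
apply: (Hd `|F x - F y|); last by exists (x, y).
by rewrite /ball /= sub0r normrN normr_id.
Qed.

Definition unit_cube d : set 'rV[R]_d := [set z | forall i, 0 <= z ord0 i <= 1].

Lemma compact_unit_cube d : compact (unit_cube d).
Proof.
have -> : unit_cube d = [set z : 'rV[R]_d | forall i, `[0, 1]%classic (z ord0 i)].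
  by apply/seteqP; split=> z /= H i; have := H i; rewrite /= in_itv.
by apply: (@rV_compact R _ (fun=> `[0, 1]%classic)) => i; exact: segment_compact.
Qed.

(** Compactness supplies the metric hypotheses of [no_thin_cube]: injectivity on the coordinates in
    [v] separates opposite faces, and continuity becomes uniform. *)
Lemma no_thin_map (d n : nat) (G : 'rV[R]_d -> 'rV[R]_n)
    (lab : 'I_d -> 'rV[R]_d -> bool) (J : {set 'I_d}) (v : pred 'I_n) :
  continuous G ->
  (forall z z', unit_cube d z -> unit_cube d z' ->
     (forall i, v i -> G z ord0 i = G z' ord0 i) -> z = z') ->
  (forall i z, i \notin J -> unit_cube d z -> z ord0 i = 0 -> lab i z = false) ->
  (forall i z, i \notin J -> unit_cube d z -> z ord0 i = 1 -> lab i z = true) ->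
  (forall (eta : R) (C : set 'rV[R]_d), 0 < eta -> C `<=` unit_cube d -> C !=set0 ->
     (forall z z', C z -> C z' -> forall i, `|G z ord0 i - G z' ord0 i| <= eta) ->
     (forall i, i \notin J -> exists z z', [/\ C z, C z' & lab i z != lab i z']) ->
     exists2 z, C z & (#|[set i | v i && (eta < `|G z ord0 i|)%R]%SET| < #|J|)%N) ->
  False.
Proof.
move=> cG injG lab0 lab1 thin.
pose Gv z : 'rV[R]_n := \row_i (if v i then G z ord0 i else 0).
have cGv : continuous Gv.
  apply: rV_near_continuous => i; under eq_fun do rewrite mxE.
  case: (v i); last exact: cst_continuous.
  move=> z; apply: (@continuous_comp _ _ _ G (fun M : 'rV[R]_n => M ord0 i)).
    exact: cG.
  exact: coord_continuous.
have GvE z i : Gv z ord0 i = if v i then G z ord0 i else 0 by rewrite mxE.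
have inj z z' : unit_cube d z -> unit_cube d z' -> Gv z = Gv z' -> idfun z = idfun z'.
  move=> Cz Cz' E; apply: injG => // i vi.
  by have := congr1 (fun r : 'rV_n => r ord0 i) E; rewrite !GvE vi.
have cid : continuous (idfun : 'rV[R]_d -> 'rV[R]_d) by move=> z; exact: cvg_id.
have [eps eps0 sep] := compact_inverse_modulus (unit_cube d) Gv idfun
  (compact_unit_cube d) cGv cid inj 1 ltr01.
apply: (no_thin_cube R d n G lab J v eps eps0 lab0 lab1 _ _ thin).
- move=> j z z' jJ Cz Cz' zj z'j; apply: contrapT => far.
  have : `|z - z'| < 1.
    apply: sep => //; apply/rV_normP => // i; rewrite !mxE.
    case: ifPn => vi; last by rewrite subrr normr0.
    by rewrite ltNge; apply/negP => le_eps; apply: far; exists i.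
  move/rV_normP => /(_ ltr01 j); rewrite !mxE zj z'j sub0r normrN normr1.
  by rewrite ltxx.
- move=> eta eta0; have uc := compact_inverse_modulus (unit_cube d) idfun G
    (compact_unit_cube d) cid cG.
  have [delta delta0 Hd] := uc (fun x y _ _ E => congr1 G E) eta eta0.
  exists (delta / 2); first by rewrite divr_gt0.
  move=> z z' Cz Cz' H i.
  have /rV_normP : `|G z - G z'| < eta.
    apply: Hd => //; apply/rV_normP => // k; rewrite !mxE.
    by apply: le_lt_trans (H k) _; lra.
  by move=> /(_ eta0 i); rewrite !mxE => /ltW.
Qed.
End Compactness.

(** * Supports, barycenters and charts of the realization *)

Section Realization.
Local Open Scope ring_scope.
Local Open Scope classical_set_scope.
Variable R : realType.

Definition supp {n} (x : 'rV[R]_n) : {set 'I_n} := [set i | x ord0 i != 0]%SET.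

(** Nonzero coordinates stay nonzero under a small move, so supports can only grow nearby. *)
Lemma supp_near n (x : 'rV[R]_n) :
  exists2 e : R, 0 < e & forall y : 'rV[R]_n, `|x - y| < e -> supp x \subset supp y.
Proof.
pose e : R := \big[Order.min/1]_(i | x ord0 i != 0) `|x ord0 i|.
have e0 : 0 < e.
  by apply/bigmin_gtP; split=> // i xi; rewrite normr_gt0.
exists e => // y /(rV_normP _ _ _ _ e0) xy; apply/fintype.subsetP => i.
rewrite !inE => xi; apply: contraTneq (xy i) => yi.
rewrite !mxE yi subr0 -leNgt.
exact: (bigmin_le_cond _ (fun i => `|x ord0 i|)).
Qed.

Lemma realizationP n (K : {set {set 'I_n}}) (x : 'rV[R]_n) :
  @realization R n K x <->
  [/\ forall i, 0 <= x ord0 i, \sum_i x ord0 i = 1 & supp x \in K].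
Proof. by split=> [[? []]|[]]. Qed.

Definition barycenter {n} (s : {set 'I_n}) : 'rV[R]_n :=
  \row_i (if i \in s then #|s|%:R^-1 else 0).

Lemma barycenterE n (s : {set 'I_n}) i :
  barycenter s ord0 i = if i \in s then #|s|%:R^-1 else 0.
Proof. by rewrite mxE. Qed.

Lemma barycenter_bounds n (s : {set 'I_n}) i : 0 <= barycenter s ord0 i <= 1.
Proof.
rewrite barycenterE; case: ifP => [si|_]; last by rewrite lexx ler01.
have s0 : (0 < #|s|)%N by apply/card_gt0P; exists i.
by rewrite invr_ge0 ler0n invf_le1 ?ltr0n // ler1n.
Qed.

Lemma supp_barycenter n (s : {set 'I_n}) : supp (barycenter s) = s.
Proof.
apply/setP => i; rewrite inE barycenterE; case: ifPn => si; last by rewrite eqxx.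
by rewrite invr_eq0 pnatr_eq0 cards_eq0; apply/finset.set0Pn; exists i.
Qed.

Lemma sum_barycenter n (s : {set 'I_n}) : s != finset.set0 ->
  \sum_i barycenter s ord0 i = 1.
Proof.
move=> s0; under eq_bigr do rewrite barycenterE.
rewrite -big_mkcond /= sumr_const -[LHS]mulr_natl divff //.
by rewrite pnatr_eq0 cards_eq0.
Qed.

Lemma realization_barycenter n (K : {set {set 'I_n}}) (s : {set 'I_n}) :
  s != finset.set0 -> s \in K -> @realization R n K (barycenter s).
Proof.
move=> s0 sK; apply/realizationP; split; last by rewrite supp_barycenter.
  by move=> i; have /andP[] := barycenter_bounds n s i.
exact: sum_barycenter.
Qed.

Lemma realization_open_star n (K : {set {set 'I_n}}) (x : 'rV[R]_n) (t : {set 'I_n}) (e : R) :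
  @realization R n K x -> supp x \subset t -> t \in K -> 0 < e ->
  exists a, [/\ @realization R n K a, `|x - a| < e & supp a = t].
Proof.
move=> /realizationP[x0 x1 xK] xt tK e0.
have xle1 i : x ord0 i <= 1.
  by rewrite -x1 (bigD1 i) //= lerDl sumr_ge0.
have [j xj] : exists j, x ord0 j != 0.
  apply: contrapT => H; have := oner_neq0 R; rewrite -x1 big1 ?eqxx // => i _.
  by apply/eqP/negPn/negP => xi; apply: H; exists i.
have t0 : t != finset.set0.
  by apply/finset.set0Pn; exists j; apply: (fintype.subsetP xt); rewrite inE.
(* The point sought is [x] moved towards the barycenter of [t] by the fraction [l]: coordinates move
   by at most [l], and 1 - l remains positive. *)
pose l : R := Num.min (e / 2) (1 / 2).
have l0 : 0 < l by rewrite lt_min !divr_gt0.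
have le2 : l <= e / 2 by rewrite ge_min lexx.
have l1 : l <= 1 / 2 by rewrite ge_min lexx orbT.
pose a : 'rV[R]_n := (1 - l) *: x + l *: barycenter t.
have aE i : a ord0 i = (1 - l) * x ord0 i + l * barycenter t ord0 i.
  by rewrite !mxE.
have sa : supp a = t.
  rewrite -[RHS](supp_barycenter n t).
  apply/setP => i; rewrite !inE aE; have /andP[b0 _] := barycenter_bounds n t i.
  have [bi0|bi] := eqVneq (barycenter t ord0 i) 0.
    suff -> : x ord0 i = 0 by rewrite bi0 !mulr0 addr0 eqxx.
    apply/eqP; apply: contraT => xi.
    have /(fintype.subsetP xt) : i \in supp x by rewrite inE.
    by rewrite -(supp_barycenter n t) inE bi0 eqxx.
  have {bi}b0' : 0 < barycenter t ord0 i by rewrite lt_def bi.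
  apply: lt0r_neq0; rewrite ltr_wpDl ?mulr_gt0 // mulr_ge0 //; lra.
exists a; split=> //.
  apply/realizationP; split; last by rewrite sa.
    move=> i; rewrite aE; have /andP[b0 _] := barycenter_bounds n t i.
    by rewrite addr_ge0 // mulr_ge0 //; lra.
  under eq_bigr do rewrite aE.
  by rewrite big_split /= -!mulr_sumr x1 sum_barycenter // !mulr1 subrK.
apply/rV_normP => // i; rewrite mxE [in X in _ + X]mxE aE.
have /andP[b0 b1] := barycenter_bounds n t i.
have -> : x ord0 i - ((1 - l) * x ord0 i + l * barycenter t ord0 i) =
  l * (x ord0 i - barycenter t ord0 i) by ring.
rewrite normrM gtr0_norm //.
have : `|x ord0 i - barycenter t ord0 i| <= 1.
  by have := x0 i; have := xle1 i; rewrite ler_norml; lra.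
by move=> /(ler_wpM2l (ltW l0)); lra.
Qed.

(** The manifold condition in epsilon-delta form, with [r] so small that every point of the chart
    has all vertices of [supp x0] in its support. *)
Lemma chart n d (K : {set {set 'I_n}}) (x0 : 'rV[R]_n) :
  @manifold_with_boundary R n d (@realization R n K) -> @realization R n K x0 ->
  exists (y0 : 'rV[R]_d) (r : R) (f : 'rV[R]_n -> 'rV[R]_d) (g : 'rV[R]_d -> 'rV[R]_n),
  [/\ 0 < r,
    forall w, @halfspace R d w -> `|y0 - w| < r ->
      [/\ @realization R n K (g w), f (g w) = w & supp x0 \subset supp (g w)],
    forall w (e : R), 0 < e -> @halfspace R d w -> `|y0 - w| < r ->
      exists2 dl : R, 0 < dl & forall w', @halfspace R d w' -> `|y0 - w'| < r ->
        `|w - w'| < dl -> `|g w - g w'| < e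
  & forall rho : R, 0 < rho -> exists2 e : R, 0 < e &
      forall x, @realization R n K x -> `|x0 - x| < e ->
        [/\ @halfspace R d (f x), `|y0 - f x| < rho & g (f x) = x]].
Proof.
move=> mfd Sx0; have [U [W [Ux0 [P oP UE] [Q oQ WE] [f [g ]]]]] := mfd x0 Sx0.
move=> [/subspace_continuousP cf /subspace_continuousP cg [fU gW] gf fg].
have W0 : W (f x0) by apply: fU; exists x0.
have Q0 : Q (f x0) by move: W0; rewrite WE => -[].
have /nbhs_ballP[r1 /= r10 Hr1] := open_nbhs_nbhs (conj oQ Q0).
have Px0 : P x0 by move: Ux0; rewrite UE => -[].
have /nbhs_ballP[e1 /= e10 He1] := open_nbhs_nbhs (conj oP Px0).
have cgE w e : 0 < e -> W w -> exists2 dl : R, 0 < dl & forall w', W w' ->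
    `|w - w'| < dl -> `|g w - g w'| < e.
  move=> e0 Ww; have /cvgrPdist_lt/(_ e e0) := cg w Ww.
  move=> /nbhs_ballP[dl /= dl0 Hdl]; exists dl => // w' Ww' ww'.
  by apply: Hdl => //; rewrite -ball_normE.
have cfE e : 0 < e -> exists2 dl : R, 0 < dl & forall x, U x ->
    `|x0 - x| < dl -> `|f x0 - f x| < e.
  move=> e0; have /cvgrPdist_lt/(_ e e0) := cf x0 Ux0.
  move=> /nbhs_ballP[dl /= dl0 Hdl]; exists dl => // x Ux xx.
  by apply: Hdl => //; rewrite -ball_normE.
have [e2 e20 He2] := supp_near n x0.
have [r2 r20 Hr2] := cgE (f x0) e2 e20 W0.
pose r := Num.min r1 r2.
have r0 : 0 < r by rewrite lt_min r10.
have inW w : @halfspace R d w -> `|f x0 - w| < r -> W w.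
  move=> Hw; rewrite lt_min => /andP[wr1 _]; rewrite WE; split=> //.
  by apply: Hr1; rewrite -ball_normE.
exists (f x0), r, f, g; split=> //.
- move=> w Hw wr; have Ww := inW w Hw wr.
  have : U (g w) by apply: gW; exists w.
  rewrite {1}UE => -[Sg _]; split=> //; first exact: fg.
  apply: He2; rewrite -{1}(gf x0 Ux0); apply: Hr2 => //.
  by move: wr; rewrite lt_min => /andP[].
- move=> w e e0 Hw wr; have [dl dl0 Hdl] := cgE w e e0 (inW w Hw wr).
  by exists dl => // w' Hw' w'r; apply: Hdl; exact: inW.
- move=> rho rho0; have [e3 e30 He3] := cfE rho rho0.
  exists (Num.min e1 e3); first by rewrite lt_min e10.
  move=> x Sx; rewrite lt_min => /andP[xe1 xe3].
  have Ux : U x by rewrite UE; split=> //; apply: He1; rewrite -ball_normE.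
  have : W (f x) by apply: fU; exists x.
  rewrite {1}WE => -[Hf _]; split=> //; first exact: He3.
  exact: gf.
Qed.
End Realization.

(** * Cubes in charts, and the size of maximal simplices *)

Section CubesInManifolds.
Local Open Scope ring_scope.
Local Open Scope classical_set_scope.
Variable R : realType.

(** The retraction of the line onto [0, 1]. It extends maps of the cube continuously to the whole
    space with the same image. *)
Definition clamp (t : R) : R := (1 + `|t| - `|t - 1|) / 2.

Lemma clamp_itv t : 0 <= clamp t <= 1.
Proof.
by rewrite /clamp; case: (ger0P t); case: (ger0P (t - 1)); lra.
Qed.

Lemma clamp_id t : 0 <= t <= 1 -> clamp t = t.
Proof.
by move=> /andP[t0 t1]; rewrite /clamp ger0_norm // ler0_norm ?subr_le0 //; field.
Qed.

Lemma clamp_continuous : continuous clamp.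
Proof.
move=> t; apply: cvgMl; apply: cvgB.
  by apply: cvgD; [exact: cvg_cst|exact: norm_continuous].
by apply: cvg_norm; apply: cvgB; [exact: cvg_id|exact: cvg_cst].
Qed.

Lemma clamp_coord_continuous d (i : 'I_d) :
  continuous (fun z : 'rV[R]_d => clamp (z ord0 i)).
Proof.
move=> z; apply: (@continuous_comp _ _ _ (fun M : 'rV[R]_d => M ord0 i) clamp).
  exact: coord_continuous.
exact: clamp_continuous.
Qed.

Lemma continuous_affine {T : topologicalType} (a b : R) (f : T -> R) :
  continuous f -> continuous (fun t => a + b * f t).
Proof.
by move=> cf t; apply: cvgD; [exact: cvg_cst|apply: cvgMr; exact: cf].
Qed.

Lemma continuous_add {T : topologicalType} (f h : T -> R) :
  continuous f -> continuous h -> continuous (fun t => f t + h t).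
Proof. by move=> cf ch t; apply: cvgD; [exact: cf|exact: ch]. Qed.

Lemma continuous_distP {T : topologicalType} {V : normedModType R} (h : T -> V) :
  continuous h <-> forall t (e : R), 0 < e -> \forall s \near t, `|h t - h s| < e.
Proof.
split=> [ch t e e0|H t]; last by apply/cvgrPdist_lt => e; exact: H.
by have /cvgrPdist_lt/(_ e e0) := ch t.
Qed.

(** Barycentric coordinates sum to 1, so those other than [v0] determine the point. Leaving [v0] out
    makes the count of large coordinates match dimension instead of number of vertices. *)
Lemma no_thin_chart n d (K : {set {set 'I_n}}) (y0 : 'rV[R]_d) (r : R)
    (f : 'rV[R]_n -> 'rV[R]_d) (g : 'rV[R]_d -> 'rV[R]_n) (k : 'rV[R]_d -> 'rV[R]_d)
    (v0 : 'I_n) (lab : 'I_d -> 'rV[R]_d -> bool) (J : {set 'I_d}) :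
  (forall w, @halfspace R d w -> `|y0 - w| < r -> @realization R n K (g w) /\ f (g w) = w) ->
  (forall w (e : R), 0 < e -> @halfspace R d w -> `|y0 - w| < r ->
      exists2 dl : R, 0 < dl & forall w', @halfspace R d w' -> `|y0 - w'| < r ->
        `|w - w'| < dl -> `|g w - g w'| < e) ->
  continuous k -> (forall z, @halfspace R d (k z)) -> (forall z, `|y0 - k z| < r) ->
  (forall z z', unit_cube R d z -> unit_cube R d z' -> k z = k z' -> z = z') ->
  (forall i z, i \notin J -> unit_cube R d z -> z ord0 i = 0 -> lab i z = false) ->
  (forall i z, i \notin J -> unit_cube R d z -> z ord0 i = 1 -> lab i z = true) ->
  (forall (eta : R) (C : set 'rV[R]_d), 0 < eta -> C !=set0 ->
     (forall z z', C z -> C z' -> forall i, `|g (k z) ord0 i - g (k z') ord0 i| <= eta) ->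
     (forall i, i \notin J -> exists z z', [/\ C z, C z' & lab i z != lab i z']) ->
     exists2 z, C z &
       (#|[set i | (i != v0) && (eta < `|g (k z) ord0 i|)%R]%SET| < #|J|)%N) ->
  False.
Proof.
move=> gS cg ck kH kr injk lab0 lab1 thin.
apply: (no_thin_map R d n (fun z => g (k z)) lab J (fun i => i != v0) _ _ lab0 lab1).
- apply/continuous_distP => z e e0.
  have [dl dl0 Hdl] := cg (k z) e e0 (kH z) (kr z).
  have /nbhs_ballP[s /= s0 Hs] := (continuous_distP k).1 ck z dl dl0.
  by apply/nbhs_ballP; exists s => // z' /Hs; exact: Hdl.
- move=> z z' Cz Cz' agree; apply: injk => //.
  have [/realizationP[_ s1 _] fgz] := gS _ (kH z) (kr z).
  have [/realizationP[_ s1' _] fgz'] := gS _ (kH z') (kr z').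
  rewrite -fgz -fgz'; congr f; apply/rowP => i; have [->|] := eqVneq i v0; last exact: agree.
  have := s1'; rewrite -[RHS]s1 (bigD1 v0) // [RHS](bigD1 v0) //=.
  by rewrite [X in _ = _ + X](eq_bigr _ agree) => /addIr.
- by move=> eta C eta0 _; exact: thin.
Qed.

(** Near the barycenter of a maximal simplex all supports equal [s]. A chart would embed a d-cube
    there using at most #|s| - 1 free coordinates, which is too thin if #|s| is at most d. *)
Lemma maximal_simplex_card n d (K : {set {set 'I_n}}) (s : {set 'I_n}) :
  simplicial_manifold R d K -> s \in K ->
  (forall t, t \in K -> s \subset t -> t = s) -> (d < #|s|)%N.
Proof.
move=> [[K0 Ksub] mfd] sK smax; rewrite ltnNge; apply/negP => sd.
have s0 : s != finset.set0 by apply: contraNneq K0 => <-.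
have Sx0 := realization_barycenter R n K s s0 sK.
have [y0 [r [f [g [r0 gS cg cf]]]]] := chart R n d K _ mfd Sx0.
have r2 : 0 < r / 2 by rewrite divr_gt0.
have [e e0 He] := cf _ r2.
have [||Hw0 w0r _] := He (barycenter R s) => //; first by rewrite subrr normr0.
set w0 := f _ in Hw0 w0r.
(* The cube has [w0] as its least corner, so it stays in the half-space; side r / 2 keeps it in the
   chart. *)
pose k (z : 'rV[R]_d) : 'rV[R]_d := \row_i (w0 ord0 i + r / 2 * clamp (z ord0 i)).
have kE z i : k z ord0 i = w0 ord0 i + r / 2 * clamp (z ord0 i) by rewrite mxE.
have [v0 v0s] : exists v0, v0 \in s by apply/finset.set0Pn.
have kH z : @halfspace R d (k z).
  move=> i i0; rewrite kE addr_ge0 ?Hw0 // mulr_ge0 ?(ltW r2) //.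
  by have /andP[] := clamp_itv (z ord0 i).
have kr z : `|y0 - k z| < r.
  apply/rV_normP => // i; rewrite mxE [in X in _ + X]mxE kE.
  move/(rV_normP _ _ _ _ r2)/(_ i): w0r; rewrite !mxE.
  have /andP[c0 c1] := clamp_itv (z ord0 i).
  have := mulr_ge0 (ltW r2) c0; have := ler_wpM2l (ltW r2) c1.
  rewrite !ltr_norml mulr1; lra.
apply: (no_thin_chart n d K y0 r f g k v0 (fun _ _ => false) [set: 'I_d]%SET _ cg _ kH kr).
- by move=> w Hw wr; have [] := gS w Hw wr.
- apply: rV_near_continuous => i; under eq_fun do rewrite kE.
  by apply: continuous_affine; exact: clamp_coord_continuous.
- move=> z z' Cz Cz' /rowP E; apply/rowP => i; have := E i; rewrite !kE.
  by move/addrI/(mulfI (lt0r_neq0 r2)); rewrite !clamp_id.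
- by move=> i z; rewrite inE.
- by move=> i z; rewrite inE.
move=> eta C eta0 [z Cz] _ _; exists z => //; rewrite cardsT card_ord.
rewrite (leq_trans _ sd) // (cardsD1 v0 s) v0s ltnS.
apply/subset_leq_card/fintype.subsetP => i; rewrite !inE => /andP[-> gi] /=.
have [/realizationP[_ _ gK] _] := gS _ (kH z) (kr z).
rewrite supp_barycenter => sg; rewrite -(smax _ gK sg) inE.
by apply: contraTneq gi => ->; rewrite normr0 -leNgt ltW.
Qed.
End CubesInManifolds.

(** * Purity and strong connectivity *)

Section Connectivity.
Local Open Scope ring_scope.
Variable R : realType.

Lemma subset_of_card (T : finType) (s : {set T}) m : (m <= #|s|)%N ->
  exists2 t : {set T}, t \subset s & #|t| = m.
Proof.
move=> ms; exists [set x in take m (enum s)].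
  by apply/fintype.subsetP => x; rewrite inE => /mem_take; rewrite mem_enum.
by rewrite cardsE (card_uniqP _) ?take_uniq ?enum_uniq // size_takel // -cardE.
Qed.

(** A maximal simplex above [s] has at least d + 1 vertices; any d + 1 of them form the facet.
    Larger simplices are not excluded at this point, so the facet is only asked to span a simplex
    with [s]. *)
Lemma simplex_in_facet n d (K : {set {set 'I_n}}) (s : {set 'I_n}) :
  simplicial_manifold R d K -> s \in K ->
  exists f, f \in facets d K /\ s :|: f \in K.
Proof.
move=> mfd sK; have [[K0 Ksub] _] := mfd.
have [t /maxsetP[/andP[tK st] tmax] _] := maxset_exists (P := fun t => (t \in K) && (s \subset t))
  (C := s) (introT andP (conj sK (subxx s))).
have dt : (d.+1 <= #|t|)%N.
  apply: (maximal_simplex_card R n d K) => // u uK tu.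
  by apply: tmax => //; rewrite uK (fintype.subset_trans st).
have [f ft cf] := subset_of_card _ _ _ dt.
have f0 : f != finset.set0 by rewrite -card_gt0 cf.
exists f; split; first by rewrite inE cf eqxx andbT; apply: Ksub ft.
apply: Ksub (tK) _ _; last by rewrite finset.subUset st.
by rewrite -card_gt0 (leq_trans _ (subset_leq_card (finset.subsetUr s f))) ?cf.
Qed.

(* If no facet outside [P] were adjacent to one in [P], the simplices joined to a
   facet in [P] and those joined to a facet outside [P] would form two subcomplexes
   meeting in dimension at most [d - 2], which cannot separate a chart. *)
Lemma facets_strongly_connected n d (K P : {set {set 'I_n}}) :
  (2 <= d)%N -> simplicial_manifold R d K -> connected (@realization R n K) ->
  P \proper facets d K -> P != finset.set0 ->
  exists f g, [/\ f \in facets d K, f \notin P, g \in P & (d <= #|f :&: g|)%N].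
Proof.
move=> d2 mfd conn /fintype.properP[PF [f0 f0F f0P]] /finset.set0Pn[g0 g0P].
have [Kcx Kmfd] := mfd; have [K0 Ksub] := Kcx.
apply: contrapT => Hno.
have closed f g : f \in facets d K -> f \notin P -> g \in P -> (#|f :&: g| < d)%N.
  by move=> fF fP gP; rewrite ltnNge; apply/negP => fg; apply: Hno; exists f, g.
have cardF g : g \in facets d K -> #|g| = d.+1 by rewrite inE => /andP[_ /eqP].
have FK g : g \in facets d K -> g \in K by rewrite inE => /andP[].
pose side (b : bool) (s : {set 'I_n}) := (s \in K) &&
  [exists f in facets d K, ((f \in P) == b) && (s :|: f \in K)].
have sideP b s : reflect (s \in K /\ exists f, [/\ f \in facets d K, (f \in P) = b
    & s :|: f \in K]) (side b s).
  apply: (iffP andP) => [[sK /exists_inP[f fF /andP[/eqP fb sf]]]|[sK [f [fF fb sf]]]].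
    by split=> //; exists f.
  by split=> //; apply/exists_inP; exists f => //; rewrite fb eqxx.
have sideW b s t : side b t -> s != finset.set0 -> s \subset t -> side b s.
  move=> /sideP[tK [f [fF fb tf]]] s0 st; apply/sideP; split; first exact: Ksub st.
  exists f; split=> //; apply: Ksub tf _ _; last exact: finset.setSU.
  by apply: contraNneq s0 => /eqP; rewrite finset.setU_eq0 => /andP[].
have side_cover s : s \in K -> side true s || side false s.
  move=> sK; have [f [fF sf]] := simplex_in_facet n d K s mfd sK.
  by apply/orP; case E : (f \in P); [left|right]; apply/sideP; split=> //; exists f.
(* Otherwise d vertices of [s] extend within [s :|: f] and [s :|: f'] to facets [g] in [P] and [g']
   outside [P], which would be adjacent. *)
have side_thin s : side true s -> side false s -> (#|s| < d)%N.
  move=> /sideP[sK [f [fF fP sf]]] /sideP[_ [f' [f'F f'P sf']]].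
  rewrite ltnNge; apply/negP => /subset_of_card[s' s's cs'].
  have extend h : h \in facets d K -> s :|: h \in K -> exists g,
      [/\ g \in facets d K, s' \subset g & g \subset s :|: h].
    move=> hF sh; have /fintype.subsetPn[x xh xs'] : ~~ (h \subset s').
      by apply/negP => /subset_leq_card; rewrite (cardF _ hF) cs' ltnn.
    have gsh : x |: s' \subset s :|: h.
      rewrite finset.subUset finset.sub1set inE xh orbT /=.
      by rewrite (fintype.subset_trans s's) // finset.subsetUl.
    exists (x |: s'); split=> //; last exact: finset.subsetUr.
    rewrite inE cardsU1 xs' cs' eqxx andbT; apply: Ksub sh _ gsh.
    by apply/finset.set0Pn; exists x; rewrite !inE eqxx.
  have [g [gF s'g gsf]] := extend f fF sf.
  have [g' [g'F s'g' g'sf']] := extend f' f'F sf'.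
  have gP : g \in P.
    apply: (adj_closed_in_simplex n d K P _ f g Kcx sf closed PF fP gF) => //.
    exact: finset.subsetUr.
  have g'P : g' \notin P.
    apply/negP => g'P; move: f'P.
    rewrite (adj_closed_in_simplex n d K P _ g' f' Kcx sf' closed PF g'P f'F) //.
    exact: finset.subsetUr.
  have := closed g' g g'F g'P gP; rewrite ltnNge -cs' => /negP; apply.
  by apply: subset_leq_card; rewrite finset.subsetI s'g'.
have facet_side f : f \in facets d K -> side (f \in P) f.
  by move=> fF; apply/sideP; rewrite FK //; split=> //; exists f; rewrite finset.setUid FK.
have side_nz s b : side b s -> s != finset.set0.
  by move=> /sideP[sK _]; apply: contraNneq K0 => <-.
(* Without a common point, the first subcomplex would be a proper nonempty clopen part of the
   realization. *)
have [x0 [Sx0 sx0t sx0f]] : exists x0, [/\ @realization R n K x0,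
    side true (supp R x0) & side false (supp R x0)].
  apply: contrapT => Hno0.
  pose A := [set x : 'rV[R]_n | @realization R n K x /\ side true (supp R x)]%classic.
  pose Z b := [set x : 'rV[R]_n | exists s, side b s /\ supp R x \subset s]%classic.
  have cZ b : topology_structure.closed (Z b).
    rewrite -openC openE => x Zx; apply/nbhs_ballP.
    have [e e0 He] := supp_near R n x; exists e => // y; rewrite -ball_normE /= => xy.
    move=> [s [bs ys]]; apply: Zx; exists s; split=> //.
    exact: fintype.subset_trans (He y xy) ys.
  have ZE b x : @realization R n K x -> Z b x <-> side b (supp R x).
    move=> /realizationP[_ _ xK]; split=> [[s [bs xs]]|bx]; last by exists (supp R x).
    by apply: sideW bs _ xs; apply: contraNneq K0 => <-.
  have AE : A = @realization R n K.
    apply: conn.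
    - exists (barycenter R g0); have g0F := fintype.subsetP PF _ g0P.
      split; last by rewrite supp_barycenter -g0P; exact: facet_side.
      by apply: realization_barycenter; rewrite ?FK // -card_gt0 (cardF _ g0F).
    - exists (~` Z false)%classic; first by rewrite openC.
      apply/seteqP; split=> x.
        move=> [Sx tx]; split=> // /(ZE false x Sx) fx; apply: Hno0.
        by exists x.
      move=> [Sx nfx]; split=> //; have /realizationP[_ _ xK] := Sx.
      by have /orP[//|fx] := side_cover _ xK; case: nfx; apply/(ZE false x Sx).
    - exists (Z true); first exact: cZ.
      by apply/seteqP; split=> x [Sx] /(ZE true x Sx).
  apply: Hno0; have f0K := FK _ f0F.
  have : @realization R n K (barycenter R f0).
    by apply: realization_barycenter; rewrite // -card_gt0 (cardF _ f0F).
  rewrite -[X in X _]AE => -[Sf tf]; exists (barycenter R f0); split=> //.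
  by rewrite supp_barycenter -(negPf f0P) facet_side.
have [v0 v0s] : exists v0, v0 \in supp R x0 by apply/finset.set0Pn; exact: side_nz sx0t.
have [y0 [r [f [g [r0 gS cg cf]]]]] := chart R n d K x0 Kmfd Sx0.
have r2 : 0 < r / 2 by rewrite divr_gt0.
have [e e0 He] := cf _ r2.
(* Near [x0] there is a point whose support contains a whole facet of side [b]. By [side_thin] it is
   off the other subcomplex, and so are all points near it. *)
have base b : side b (supp R x0) -> exists p : 'rV[R]_d, exists dl : R,
    [/\ @halfspace R d p, `|y0 - p| < r / 2, 0 < dl & forall w, @halfspace R d w ->
       `|y0 - w| < r -> `|p - w| < dl -> ~~ side (~~ b) (supp R (g w))].
  move=> /sideP[x0K [h [hF hb sh]]].
  have [a [Sa x0a sa]] := realization_open_star R n K x0 (supp R x0 :|: h) e Sx0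
    (finset.subsetUl _ _) sh e0.
  have [Hp pr gp] := He a Sa x0a.
  have [e1 e10 He1] := supp_near R n a.
  have pr' : `|y0 - f a| < r by apply: lt_trans pr _; lra.
  have [dl dl0 Hdl] := cg (f a) e1 e10 Hp pr'.
  exists (f a), dl; split=> // w Hw wr pw; apply/negP => bw.
  have aw : supp R a \subset supp R (g w) by apply: He1; rewrite -gp; exact: Hdl.
  have sab : side b (supp R a).
    apply/sideP; split; first by rewrite sa.
    by exists h; split=> //; rewrite sa -finset.setUA finset.setUid.
  have sanb : side (~~ b) (supp R a) by apply: sideW bw (side_nz _ _ sab) aw.
  have : (#|supp R a| < d)%N by case: b {hb Hdl bw} sab sanb => ? ?; apply: side_thin.
  rewrite ltnNge => /negP; apply; rewrite sa.
  by rewrite (leq_trans _ (subset_leq_card (finset.subsetUr _ h))) ?(cardF _ hF).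
have [p [dp [Hp pr dp0 pside]]] := base true sx0t.
have [q [dq [Hq qr dq0 qside]]] := base false sx0f.
have ltr2 : r / 2 < r by lra.
have [j pqj] : exists j, p ord0 j != q ord0 j.
  apply: contrapT => Hpq.
  have pq : p = q.
    by apply/rowP => i; apply/eqP/negPn/negP => pqi; apply: Hpq; exists i.
  have npt := pside p Hp (lt_trans pr ltr2).
  have npf := qside p Hp (lt_trans pr ltr2).
  rewrite subrr normr0 in npt; rewrite -pq subrr normr0 in npf.
  have [/realizationP[_ _ gK] _ _] := gS p Hp (lt_trans pr ltr2).
  by have := side_cover _ gK; rewrite (negPf (npt dp0)) (negPf (npf dq0)).
(* Thin enough that the tube stays in the chart and each of its ends avoids one subcomplex. *)
pose dl : R := Num.min (r / 2) (Num.min dp dq) / 2.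
have m0 : 0 < Num.min (r / 2) (Num.min dp dq) by rewrite !lt_min r2 dp0.
have dl0 : 0 < dl by rewrite divr_gt0.
have [dlr dldp dldq] : [/\ dl < r / 2, dl < dp & dl < dq].
  have lem : dl < Num.min (r / 2) (Num.min dp dq) by rewrite /dl; lra.
  by move: lem; rewrite !lt_min => /and3P[].
(* The tube around the segment from [p] to [q]: direction [j], in which [p] and [q]
   differ, runs along the segment and the other directions thicken it. The offsets
   are nonnegative so that the tube stays in the half-space. *)
pose dj (i : 'I_d) : R := if i == j then 0 else dl.
pose k (z : 'rV[R]_d) : 'rV[R]_d := \row_i ((p ord0 i +
  (q ord0 i - p ord0 i) * clamp R (z ord0 j)) + (0 + dj i * clamp R (z ord0 i))).
have kE z i : k z ord0 i = p ord0 i +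
  (q ord0 i - p ord0 i) * clamp R (z ord0 j) + dj i * clamp R (z ord0 i).
  by rewrite mxE add0r.
have dj_bounds i (c : R) : 0 <= c <= 1 -> 0 <= dj i * c <= dl.
  move=> /andP[c0 c1]; rewrite /dj; case: eqP => _; first by rewrite mul0r lexx ltW.
  by rewrite mulr_ge0 ?(ltW dl0) //= ler_piMr // ltW.
have kH z : @halfspace R d (k z).
  move=> i i0; rewrite kE; have /andP[c0 c1] := clamp_itv R (z ord0 j).
  have /andP[b0 b1] := dj_bounds i _ (clamp_itv R (z ord0 i)).
  have := Hp i i0; have := Hq i i0; nra.
have kr z : `|y0 - k z| < r.
  apply/rV_normP => // i; rewrite mxE [in X in _ + X]mxE kE.
  have /andP[c0 c1] := clamp_itv R (z ord0 j).
  have /andP[b0 b1] := dj_bounds i _ (clamp_itv R (z ord0 i)).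
  move/(rV_normP _ _ _ _ r2)/(_ i): pr; rewrite !mxE.
  move/(rV_normP _ _ _ _ r2)/(_ i): qr; rewrite !mxE.
  rewrite !ltr_norml => /andP[q1 q2] /andP[p1 p2].
  by apply/andP; split; nra.
have kdist (z w : 'rV[R]_d) (c : R) : z ord0 j = c -> (c == 0) || (c == 1) ->
    w = (if c == 0 then p else q) -> `|w - k z| <= dl.
  move=> zj c01 ->; rewrite leNgt; apply/negP => H.
  have : `|(if c == 0 then p else q) - k z| < `|(if c == 0 then p else q) - k z|.
    apply/rV_normP; first exact: lt_trans dl0 H.
    move=> i; apply: le_lt_trans H; rewrite mxE [in X in _ + X]mxE kE zj.
    have /andP[b0 b1] := dj_bounds i _ (clamp_itv R (z ord0 i)).
    by case/orP: c01 => /eqP ->; rewrite ?eqxx ?oner_eq0 clamp_id ?lexx ?ler01 //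
      ler_norml; lra.
  by rewrite ltxx.
(* The label of direction [j] tells whether the first subcomplex has been left; the other d - 1
   directions form [J]. *)
pose lab (i : 'I_d) (z : 'rV[R]_d) := ~~ side true (supp R (g (k z))).
have gkK z : supp R (g (k z)) \in K.
  by have [/realizationP[]] := gS _ (kH z) (kr z).
have notJ i : i \notin [set~ j] -> i = j by rewrite !inE negbK => /eqP.
apply: (no_thin_chart R n d K y0 r f g k v0 lab [set~ j] _ cg _ kH kr).
- by move=> w Hw wr; have [] := gS w Hw wr.
- apply: rV_near_continuous => i; under eq_fun do rewrite mxE.
  apply: continuous_add; apply: continuous_affine; exact: clamp_coord_continuous.
- move=> z z' Cz Cz' /rowP E.
  have Ej : z ord0 j = z' ord0 j.
    have := E j; rewrite !kE /dj eqxx !mul0r !addr0 => /addrI.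
    have qpj : q ord0 j - p ord0 j != 0 by rewrite subr_eq0 eq_sym.
    by move/(mulfI qpj); rewrite !clamp_id.
  apply/rowP => i; have [->//|ij] := eqVneq i j.
  have := E i; rewrite !kE Ej /dj (negPf ij) => /addrI/(mulfI (lt0r_neq0 dl0)).
  by rewrite !clamp_id.
- move=> i z /notJ-> _ zj; rewrite /lab; apply/negbTE; rewrite negbK.
  have := side_cover _ (gkK z); rewrite orbC => /orP[|//].
  have := pside (k z) (kH z) (kr z) => /= H /idP; rewrite (negPf (H _)) //.
  apply: le_lt_trans dldp; apply: (kdist z p 0) => //; by rewrite eqxx.
- move=> i z /notJ-> _ zj; rewrite /lab.
  apply: (qside (k z) (kH z) (kr z)); apply: le_lt_trans dldq.
  by apply: (kdist z q 1); rewrite ?eqxx ?orbT // oner_eq0.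
move=> eta C eta0 _ Cclose Clab.
have [|z [z' [Cz Cz' labzz']]] := Clab j; first by rewrite !inE eqxx.
wlog labz : z z' Cz Cz' labzz' / side true (supp R (g (k z))).
  move=> W; have [labz|labz] := boolP (side true (supp R (g (k z)))).
    exact: (W z z').
  apply: (W z' z) => //; first by rewrite eq_sym.
  by move: labzz'; rewrite /lab labz /= => /negbNE.
have labz' : side false (supp R (g (k z'))).
  have /orP[tz'|//] := side_cover _ (gkK z').
  by move: labzz'; rewrite /lab labz tz'.
exists z => //; rewrite cardsC1 card_ord.
(* A coordinate larger than [eta] at [z] is nonzero at [z'] too. With [v0], present in every support
   of the chart, [T] spans a simplex of both subcomplexes, so [side_thin] bounds it. *)
set T := [set i | _]%SET.
have v0g z1 : v0 \in supp R (g (k z1)).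
  by have [_ _ /fintype.subsetP] := gS _ (kH z1) (kr z1); apply.
have Tz : v0 |: T \subset supp R (g (k z)).
  rewrite finset.subUset finset.sub1set v0g /=; apply/fintype.subsetP => i.
  rewrite !inE => /andP[_ gi].
  by apply: contraTneq gi => ->; rewrite normr0 -leNgt ltW.
have Tz' : v0 |: T \subset supp R (g (k z')).
  rewrite finset.subUset finset.sub1set v0g /=; apply/fintype.subsetP => i.
  rewrite !inE => /andP[_ gi]; have := Cclose z z' Cz Cz' i.
  by apply: contraTneq => ->; rewrite subr0 -ltNge.
have T0 : v0 |: T != finset.set0.
  by apply/finset.set0Pn; exists v0; rewrite !inE eqxx.
have := side_thin _ (sideW _ _ _ labz T0 Tz) (sideW _ _ _ labz' T0 Tz').
by rewrite cardsU1 !inE eqxx /= add1n; case: (d) d2.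
Qed.
End Connectivity.

(** * From strong connectivity to the facet cycle *)

Theorem theorem7 (R : realType) (n d : nat) (K : {set {set 'I_n}}) :
  (3 <= d)%N ->
  @simplicial_manifold R n d K ->
  K != finset.set0 ->
  connected (@realization R n K) ->
  ~ single_simplex d K ->
  has_facet_cycle d K.
Proof.
move=> d3 mfd Kn0 conn nsingle; have [[K0 Ksub] _] := mfd.
apply: facet_cycle_of_connected => // [|P]; last first.
  exact: (facets_strongly_connected R n d K P (ltnW d3) mfd conn).
(* It remains to find two facets: with a unique facet [f], the complex is shown to be the full
   simplex on [f]. *)
rewrite ltnNge; apply/negP => /card_le1_eqP F1; apply: nsingle.
have [s sK] := finset.set0Pn _ Kn0.
have [f [fF _]] := simplex_in_facet R n d K s mfd sK.
have /andP[fK /eqP cf] : (f \in K) && (#|f| == d.+1) by move: fF; rewrite inE.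
exists f; split=> //; apply/setP => t; rewrite inE; apply/idP/andP => [tK|[t0 tf]].
  split; first by apply: contraNneq K0 => <-.
  have [f' [f'F tf'K]] := simplex_in_facet R n d K t mfd tK.
  rewrite (F1 _ _ fF f'F) in tf'K.
  apply: contraT => /fintype.subsetPn[x xt xf].
  have /card_gt0P[y yf] : (0 < #|f|)%N by rewrite cf.
  (* A vertex [x] of [t] outside [f] could replace a vertex of [f] inside the simplex [t :|: f],
     giving a second facet. *)
  have hF : x |: f :\ y \in facets d K.
    rewrite inE cardsU1 !inE (negPf xf) andbF /= add1n eqSS.
    have := cardsD1 y f; rewrite yf cf add1n => -[<-]; rewrite eqxx andbT.
    apply: Ksub tf'K _ _; first by apply/finset.set0Pn; exists x; rewrite !inE eqxx.
    rewrite finset.subUset finset.sub1set inE xt /=.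
    exact: fintype.subset_trans (finset.subsetDl _ _) (finset.subsetUr _ _).
  by rewrite (F1 _ _ hF fF) !inE eqxx in xf.
exact: Ksub fK t0 tf.
Qed.
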